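(* Let $n,k,\lambda,\mu$ be nonnegative integers such that $0<k<n-1$, such that $(n-1-k)\mu = k(k-1-\lambda)$, and such that both numbers \[ \frac{1}{2}\left(n-1 \pm \frac{(n-1)(\lambda-\mu)+2k}{\sqrt{(\lambda-\mu)^2+4(k-\mu)}}\right) \] are nonnegative integers. Define $c_0,c_1,c_2,\ldots$ by $c_0=n$, $c_1=0$, and for $\ell\ge 2$, \[ c_{\ell} \,=\, \mu n k^{\ell-2} + (\lambda-\mu)\, c_{\ell-1} + (k-\mu)\, c_{\ell-2}. \] Then every prime $p$ divides the integer $c_p$. *)

(* Defs.v *)
From mathcomp Require Export all_boot all_order all_algebra.
From mathcomp Require Export reals.

(* Main.v *)
(** Write [e = lambda - mu].  The roots [r, s] of [X^2 - e X - (k - mu)] are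
    algebraic integers, and solving the recurrence gives
    [c l = k^l + g r^l + f s^l], where [f] and [g] are the two numbers assumed
    to be nonnegative integers; in particular [k + g r + f s = c 1 = 0].  Raising
    this relation to the power [p] is additive modulo [p], so
    [0 = (k + g r + f s)^p == k^p + g r^p + f s^p = c p] modulo [p] in the ring of
    algebraic integers, and an integer divisible by [p] there is divisible by
    [p] in [int]. *)

Require Import Defs.
From mathcomp Require Import all_boot all_order all_algebra reals.
From mathcomp Require Import algC algnum ring zify.
Import Order.TTheory GRing.Theory Num.Theory.
Local Open Scope ring_scope.

(** In the binomial expansion, [p] divides every coefficient except the two outer ones. *)
Lemma eqAmod_exprD (p : nat) (x y : algC) : prime p ->
  x \in Aint -> y \in Aint -> ((x + y) ^+ p == x ^+ p + y ^+ p %[mod p])%A.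
Proof.
case: p => // p p_pr xA yA.
rewrite exprDn big_ord_recl big_ord_recr /= subn0 subnn !bin0 binn.
rewrite !mulr1n !expr0 mul1r mulr1 /eqAmod addrCA addrK.
rewrite rpred_sum // => i _.
have /dvdnP[q ->] : (p.+1 %| 'C(p.+1, bump 0 i))%N.
  by apply: prime_dvd_bin => //; rewrite /bump /= ltnS ltn_ord.
rewrite mulrnA -mulr_natr -eqAmod0 eqAmodMl0 //.
by rewrite rpredMn // rpredM // rpredX.
Qed.

Lemma eqAmod_exp_sum (p : nat) (I : Type) (s : seq I) (F : I -> algC) :
  prime p -> (forall i, F i \in Aint) ->
  ((\sum_(i <- s) F i) ^+ p == \sum_(i <- s) F i ^+ p %[mod p])%A.
Proof.
move=> p_pr FA; elim: s => [|i s IHs].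
  by rewrite !big_nil expr0n gtn_eqF ?prime_gt0 ?eqAmod_refl.
rewrite !big_cons (eqAmod_transl _ (eqAmod_exprD _ _ _ _ _ _)) ?rpred_sum //.
by rewrite eqAmodDl.
Qed.

(** Treating [x *+ m] as a sum of [m] copies of [x] makes additivity of the [p]-th power suffice,
    without a separate appeal to Fermat's little theorem for [m]. *)
Lemma eqAmod_exprMn (p m : nat) (x : algC) : prime p -> x \in Aint ->
  ((x *+ m) ^+ p == x ^+ p *+ m %[mod p])%A.
Proof.
move=> p_pr xA; rewrite -[m]card_ord -!sumr_const.
exact: (eqAmod_exp_sum p _ (index_enum _)).
Qed.

(** The powers of [r] and [s] solve the homogeneous recurrence, and [k ^+ l] is a particular
    solution because [k^2 - (r + s) k + r s = (k - r)(k - s)]. *)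
Lemma linear_recurrence_closed_form (A : comNzRingType) (k r s f g : A)
    (c : nat -> A) :
  c 0 = 1 + g + f -> c 1 = k + g * r + f * s ->
  (forall l, c l.+2 = (k - r) * (k - s) * k ^+ l + (r + s) * c l.+1
                      - r * s * c l) ->
  forall l, c l = k ^+ l + g * r ^+ l + f * s ^+ l.
Proof.
move=> c0 c1 cSS l.
suff [] : c l = k ^+ l + g * r ^+ l + f * s ^+ l /\
          c l.+1 = k ^+ l.+1 + g * r ^+ l.+1 + f * s ^+ l.+1 by [].
elim: l => [|l [IH0 IH1]]; first by rewrite c0 c1 !expr0 !expr1 !mulr1.
by split=> //; rewrite cSS IH0 IH1 !exprS; ring.
Qed.

Lemma discriminant_gt0 (n k lambda mu : nat) : (0 < k < n - 1)%N ->
  (n%:Z - 1 - k%:Z) * mu%:Z = k%:Z * (k%:Z - 1 - lambda%:Z) ->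
  0 < (lambda%:Z - mu%:Z) ^+ 2 + 4 * (k%:Z - mu%:Z).
Proof.
move=> /andP[k_gt0 k_lt] hpar.
have h : 0 <= k%:Z * (k%:Z - 1 - lambda%:Z) by rewrite -hpar; nia.
have lek : 0 <= k%:Z - 1 - lambda%:Z by nia.
(* If [k - 1 - lambda = 0], then [mu = 0] since [n - 1 - k > 0], and the discriminant is
   [lambda^2 + 4 k]. Otherwise it is a square plus a positive term. *)
case: (eqVneq (k%:Z - 1 - lambda%:Z) 0) => [e|ne].
  have mu0 : mu%:Z = 0 by move: hpar; rewrite e mulr0; nia.
  by rewrite mu0; nia.
have -> : (lambda%:Z - mu%:Z) ^+ 2 + 4 * (k%:Z - mu%:Z) =
  (mu%:Z - lambda%:Z - 2) ^+ 2 + 4 * (k%:Z - 1 - lambda%:Z) by ring.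
by rewrite ltr_wpDl ?sqr_ge0 // mulr_gt0 // lt_def ne.
Qed.

Lemma root_quadratic_Aint (b c : int) (x : algC) :
  x ^+ 2 = b%:~R * x + c%:~R -> x \in Aint.
Proof.
move=> xE; pose q : {poly algC} := - (b%:~R *: 'X + c%:~R%:P).
have sq : (size q < size ('X^2 : {poly algC}))%N.
  rewrite size_polyXn ltnS size_polyN (leq_trans (size_polyD _ _)) // geq_max.
  rewrite (leq_trans (size_scale_leq _ _)) ?size_polyX //.
  by rewrite size_polyC; case: eqP.
apply: (@root_monic_Aint ('X^2 + q)).
- rewrite rootE hornerD hornerXn hornerN hornerD hornerZ hornerX hornerC.
  by rewrite xE subrr.
- by rewrite monicE lead_coefDl // lead_coefXn.
- apply/polyOverP => i.
  rewrite coefD coefXn coefN coefD coefZ coefX coefC.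
  rewrite rpredD ?rpredN ?rpredD ?rpredM ?intr_int ?rpred_nat //.
  by case: ifP; rewrite ?intr_int ?rpred0.
Qed.

Theorem theorem3 (R : realType) (n k lambda mu : nat)
  (hk : (0 < k < n - 1)%N)
  (hpar : (n%:Z - 1 - k%:Z) * mu%:Z = k%:Z * (k%:Z - 1 - lambda%:Z))
  (hplus : 2^-1 * (n%:R - 1 +
      ((n%:R - 1) * (lambda%:R - mu%:R) + 2 * k%:R) /
        Num.sqrt ((lambda%:R - mu%:R) ^+ 2 + 4 * (k%:R - mu%:R)))
    \is a @Num.nat R)
  (hminus : 2^-1 * (n%:R - 1 -
      ((n%:R - 1) * (lambda%:R - mu%:R) + 2 * k%:R) /
        Num.sqrt ((lambda%:R - mu%:R) ^+ 2 + 4 * (k%:R - mu%:R)))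
    \is a @Num.nat R)
  (c : nat -> int)
  (hc0 : c 0%N = n%:Z)
  (hc1 : c 1%N = 0)
  (hc : forall l : nat, (2 <= l)%N ->
    c l = mu%:Z * n%:Z * k%:Z ^+ (l - 2)%N
          + (lambda%:Z - mu%:Z) * c (l - 1)%N
          + (k%:Z - mu%:Z) * c (l - 2)%N)
  (p : nat) (hp : prime p) :
  (p%:Z %| c p)%Z.
Proof.
have D_gt0 := discriminant_gt0 n k lambda mu hk hpar.
set D := (lambda%:Z - mu%:Z) ^+ 2 + 4 * (k%:Z - mu%:Z) in D_gt0.
pose X := (n%:Z - 1) * (lambda%:Z - mu%:Z) + 2 * k%:Z.
have DR : (lambda%:R - mu%:R) ^+ 2 + 4 * (k%:R - mu%:R) = D%:~R :> R.
  by rewrite /D; ring.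
have XR : (n%:R - 1) * (lambda%:R - mu%:R) + 2 * k%:R = X%:~R :> R.
  by rewrite /X; ring.
move: hplus hminus; rewrite DR XR => /natrP[f fE] /natrP[g gE].
set w := Num.sqrt (D%:~R : R) in fE gE.
have wD : w ^+ 2 = D%:~R by rewrite sqr_sqrtr // ler0z ltW.
have w_neq0 : w != 0 by rewrite gt_eqF // sqrtr_gt0 ltr0z.
have fDg : f%:Z + g%:Z = n%:Z - 1.
  apply: (@intr_inj R); rewrite rmorphD rmorphB /= -!pmulrn -fE -gE.
  by field.
(* Here [f - g = X / w]. Squaring eliminates the real number [w], leaving an integer identity that
   can be carried over to [algC]. *)
have fBg : (f%:Z - g%:Z) ^+ 2 * D = X ^+ 2.
  apply: (@intr_inj R); rewrite rmorphM !rmorphXn rmorphB /= -!pmulrn -fE -gE.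
  rewrite -wD; by field.
(* The squared identity fixes [(f - g) * sqrtC D] only up to sign, so [t] is whichever square root
   of [D] gives [X] itself. *)
have [t tD tX] : exists2 t : algC,
    t ^+ 2 = D%:~R & (f%:R - g%:R) * t = X%:~R.
  have : ((f%:R - g%:R) * sqrtC D%:~R) ^+ 2 = X%:~R ^+ 2 :> algC.
    by rewrite exprMn sqrtCK -rmorphXn -fBg rmorphM rmorphXn rmorphB.
  move/eqP; rewrite eqf_sqr => /orP[] /eqP tE.
    by exists (sqrtC D%:~R); rewrite ?sqrtCK.
  by exists (- sqrtC D%:~R); rewrite ?sqrrN ?sqrtCK // mulrN tE opprK.
pose e := lambda%:Z - mu%:Z; pose q := k%:Z - mu%:Z.
pose r : algC := (e%:~R + t) / 2; pose s : algC := (e%:~R - t) / 2.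
have tE : t ^+ 2 = e%:~R ^+ 2 + 4 * q%:~R.
  by rewrite tD /D /e /q; ring.
have rDs : r + s = e%:~R by rewrite /r /s; field.
have rMs : r * s = - q%:~R.
  have -> : r * s = (e%:~R ^+ 2 - t ^+ 2) / 4 by rewrite /r /s; field.
  by rewrite tE; field.
have rA : r \in Aint.
  by apply: (@root_quadratic_Aint e q); rewrite -rDs -[q%:~R]opprK -rMs; ring.
have sA : s \in Aint.
  by apply: (@root_quadratic_Aint e q); rewrite -rDs -[q%:~R]opprK -rMs; ring.
(* Twice the left side is [2 k + (f + g) e - (f - g) t], which is [X - X]. This is why [g] goes with
   [r] and [f] with [s]. *)
have lin : k%:R + g%:R * r + f%:R * s = 0 :> algC.
  have fg : f%:R + g%:R = n%:R - 1 :> algC.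
    by have /(congr1 (intr : int -> algC)) := fDg; rewrite rmorphD rmorphB.
  have XE : X%:~R = (f%:R + g%:R) * e%:~R + 2 * k%:R :> algC.
    by rewrite fg /X /e; ring.
  rewrite (_ : _ + _ = (2 * k%:R + (f%:R + g%:R) * e%:~R
                        - (f%:R - g%:R) * t) / 2); last by rewrite /r /s; field.
  by rewrite tX XE; field.
clearbody r s.
have cE l : (c l)%:~R = k%:R ^+ l + g%:R * r ^+ l + f%:R * s ^+ l :> algC.
  apply: (@linear_recurrence_closed_form _ k%:R r s f%:R g%:R
            (fun i => (c i)%:~R)) => [||i].
  - rewrite hc0 (_ : n%:Z = 1 + g%:Z + f%:Z); last by lia.
    by rewrite !rmorphD.
  - by rewrite hc1 lin.
  rewrite hc // subn2 subn1 /=.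
  have -> : (k%:R - r) * (k%:R - s) = k%:R ^+ 2 - (r + s) * k%:R + r * s by ring.
  rewrite rDs rMs.
  (* By [hpar], the inhomogeneous coefficient [mu * n] is [(k - r)(k - s)], as the closed form
     requires. *)
  have -> : mu%:Z * n%:Z = k%:Z ^+ 2 - e * k%:Z - q.
    by move: hpar; rewrite /e /q; nia.
  rewrite -/e -/q; clearbody e q.
  by rewrite !(intrD, rmorphB, intrM, rmorphXn) /=; ring.
have : ((c p)%:~R == 0 %[mod p])%A.
  have kgA : k%:R + g%:R * r \in Aint by rewrite rpredD ?rpredM ?rpred_nat.
  have fA : f%:R * s \in Aint by rewrite rpredM ?rpred_nat.
  have := eqAmod_exprD p _ _ hp kgA fA; rewrite lin expr0n gtn_eqF ?prime_gt0 //.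
  rewrite eqAmod_sym cE; apply: eqAmod_trans; rewrite eqAmod_sym.
  apply: eqAmodD; last by rewrite !mulr_natl eqAmod_exprMn.
  apply: (eqAmod_trans (eqAmod_exprD _ _ _ _ _ _)); rewrite ?rpredM ?rpred_nat //.
  by rewrite eqAmodDl !mulr_natl eqAmod_exprMn.
(* The quotient of [c p] by [p] is a rational algebraic integer, hence an integer. *)
rewrite eqAmod0_rat ?rpred_nat ?rpred_int // dvdC_int ?intr_int //.
by rewrite intrKfloor dvdzE.
Qed.
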